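(* Let $G$ be a graph with maximum degree $\Delta(G)\geq 8$ and maximum average degree ${\rm mad}(G)<\frac{14}{3}$. Then $\chi''_\Sigma(G)\leq \Delta(G)+3$.
   Context: Graphs are finite and simple. A proper total $k$-colouring of a graph $G=(V,E)$ is a map $c:V\cup E\to\{1,2,\ldots,k\}$ such that adjacent vertices receive distinct colours, adjacent edges (edges sharing an end-vertex) receive distinct colours, and every edge receives a colour distinct from the colours of both its end-vertices. For such $c$ and $w\in V$, let $s(w)=c(w)+\sum_{e\ni w}c(e)$, the sum over edges incident with $w$. A total neighbour sum distinguishing $k$-colouring (tnsd $k$-colouring) is a proper total $k$-colouring with $s(u)\neq s(v)$ for every edge $uv\in E$. The total neighbour sum distinguishing index $\chi''_\Sigma(G)$ is the least $k$ for which $G$ admits a tnsd $k$-colouring. The maximum average degree is ${\rm mad}(G)=\max\{2|E(H)|/|V(H)| : H\subseteq G\}$. *)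

(* Defs.v *)
From mathcomp Require Import all_boot all_order.
Set Implicit Arguments. Unset Strict Implicit. Unset Printing Implicit Defensive.

Definition simple_graph (T : finType) (g : rel T) : Prop :=
  symmetric g /\ irreflexive g.

Definition deg (T : finType) (g : rel T) (v : T) : nat := #|[set u | g v u]|.

Definition maxdeg (T : finType) (g : rel T) : nat := \max_(v : T) deg g v.

(* mad(G) < a/b :  for every subgraph H = (S, h) of G with S nonempty,
   2|E(H)|/|V(H)| < a/b, i.e. b * 2|E(H)| < a * |S|.
   2|E(H)| is the number of ordered pairs (u,v) with h u v. *)
Definition mad_lt (T : finType) (g : rel T) (a b : nat) : Prop :=
  forall (S : {set T}) (h : rel T),
    symmetric h ->
    (forall u v, h u v -> g u v) ->
    (forall u v, h u v -> (u \in S) && (v \in S)) ->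
    0 < #|S| ->
    b * #|[set p : T * T | h p.1 p.2]| < a * #|S|.

Definition proper_total_colouring (T : finType) (g : rel T) (k : nat)
    (cv : T -> nat) (ce : T -> T -> nat) : Prop :=
  (forall v, 1 <= cv v <= k) /\
  (forall u v, g u v -> 1 <= ce u v <= k) /\
  (forall u v, g u v -> ce u v = ce v u) /\
  (forall u v, g u v -> cv u != cv v) /\
  (forall u v w, g u v -> g u w -> v != w -> ce u v != ce u w) /\
  (forall u v, g u v -> ce u v != cv u).

Definition colour_sum (T : finType) (g : rel T) (cv : T -> nat)
    (ce : T -> T -> nat) (w : T) : nat :=
  cv w + \sum_(u : T | g w u) ce w u.

Definition tnsd_colouring (T : finType) (g : rel T) (k : nat)
    (cv : T -> nat) (ce : T -> T -> nat) : Prop :=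
  proper_total_colouring g k cv ce /\
  (forall u v, g u v -> colour_sum g cv ce u != colour_sum g cv ce v).

(* chi''_Sigma(G) <= k  iff  G admits a tnsd k-colouring
   (a tnsd k-colouring is also a tnsd k'-colouring for k' >= k). *)
Definition tnsd_index_le (T : finType) (g : rel T) (k : nat) : Prop :=
  exists cv ce, tnsd_colouring g k cv ce.

(* Main.v *)
Require Import Defs.
From mathcomp Require Import all_boot all_order all_algebra.
From mathcomp Require Import zify.
Set Implicit Arguments. Unset Strict Implicit. Unset Printing Implicit Defensive.

(* Fix D >= 8 and a graph of maximum degree at most D with as few edges as possible that has no
   tnsd (D + 3)-colouring.  Vertices of degree at most 3 ("small") can always be coloured last.
   Hence, for a vertex v, one may delete some edges from v to small neighbours and to
   4-neighbours, colour the rest by minimality, forget the colours of v, of these 4-neighbours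
   and of all small vertices, and look for new colours of v, of the deleted edges and of the
   4-neighbours.  All constraints say that a linear form avoids a value, so the Combinatorial
   Nullstellensatz applies as soon as one coefficient of a product of linear forms is nonzero;
   at most six variables are needed, whatever D is.  This excludes many small neighbours or
   4-neighbours around v.  On the subgraph induced by the vertices of degree at least 3, moving
   5/3 to every 3-vertex and 1/2 to every 4-vertex along each of their edges then gives average
   degree at least 14/3. *)

Section Algebra.
Import Order.TTheory GRing.Theory Num.Theory.
Local Open Scope ring_scope.

(** * The Combinatorial Nullstellensatz for products of linear forms *)

Section Nullstellensatz.
Variable F : fieldType.

(** The sum of [lagrange_weight A a * p(a)] over [a] in [A] is the divided difference of [p] on
    [A]. *)
Definition lagrange_weight (A : seq F) (a : F) : F :=
  (\prod_(b <- A | b != a) (a - b))^-1.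

(** Lagrange interpolation at the [k.+1] points of [A] reproduces ['X^j]; compare the coefficients
    of degree [k]. *)
Lemma lagrange_weight_sum (A : seq F) (k j : nat) :
    uniq A -> size A = k.+1 -> (j <= k)%N ->
  \sum_(a <- A) lagrange_weight A a * a ^+ j = (j == k)%:R.
Proof.
move=> uA sA jk.
pose l a : {poly F} := \prod_(b <- A | b != a) ('X - b%:P).
have sl a : a \in A -> size (l a) = k.+1.
  move=> aA; rewrite /l -big_filter size_prod_XsubC size_filter.
  have := count_predC (pred1 a) A.
  by rewrite count_uniq_mem // aA sA add1n => -[->].
have lm a : a \in A -> (l a)`_k = 1.
  move=> aA; rewrite /l; have := monic_prod_XsubC A (fun b => b != a) id.
  by rewrite monicE lead_coefE -/(l a) sl //= => /eqP.
have le a c : c \in A -> (l a).[c] = (a == c)%:R * \prod_(b <- A | b != a) (a - b).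
  move=> cA; rewrite /l horner_prod; case: eqP => [->|/eqP ac].
    by rewrite mul1r; apply: eq_bigr => b _; rewrite hornerXsubC.
  rewrite mul0r; apply/eqP; rewrite prodf_seq_eq0; apply/hasP; exists c => //=.
  by rewrite eq_sym ac hornerXsubC subrr eqxx.
pose q : {poly F} := \sum_(a <- A) (lagrange_weight A a * a ^+ j) *: l a.
have qX : q = 'X^j.
  apply/eqP; rewrite -subr_eq0; apply/eqP.
  apply: (@roots_geq_poly_eq0 _ _ A) => //.
    apply/allP=> c cA; rewrite rootE hornerD hornerN hornerXn subr_eq0.
    rewrite horner_sum (bigD1_seq c) //= hornerZ le // eqxx mul1r /lagrange_weight.
    rewrite mulrAC mulVf ?mul1r; last first.
      by rewrite prodf_seq_neq0; apply/allP=> b _; apply/implyP; rewrite subr_eq0 eq_sym.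
    by rewrite big1 ?addr0 // => a ac; rewrite hornerZ le // (negbTE ac) mul0r mulr0.
  rewrite sA (leq_trans (size_polyD _ _)) // geq_max size_polyN size_polyXn ltnS jk andbT.
  rewrite /q big_seq; apply: (big_ind (fun p : {poly F} => size p <= k.+1)%N).
  - by rewrite size_poly0.
  - by move=> p1 p2 h1 h2; rewrite (leq_trans (size_polyD _ _)) // geq_max h1.
  - by move=> a aA; rewrite (leq_trans (size_scale_leq _ _)) // sl.
have := congr1 (fun p : {poly F} => p`_k) qX.
rewrite /q coef_sum coefXn eq_sym => <-.
by apply: eq_big_seq => a aA; rewrite coefZ lm // mulr1.
Qed.

Fixpoint mono (b : seq nat) (x : seq F) : F :=
  match b, x with
  | k :: b', a :: x' => a ^+ k * mono b' x'
  | _, _ => 1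
  end.

(* Iterated divided difference over the grid given by [As]. *)
Fixpoint grid_sum (As : seq (seq F)) (p : seq F -> F) : F :=
  if As is A :: As' then
    \sum_(a <- A) lagrange_weight A a * grid_sum As' (fun x => p (a :: x))
  else p [::].

Lemma eq_grid_sum As p q :
  (forall x, size x = size As -> p x = q x) -> grid_sum As p = grid_sum As q.
Proof.
elim: As p q => [|A As IH] p q pq /=; first exact: pq.
by apply: eq_bigr => a _; congr (_ * _); apply: IH => x sx; apply: pq; rewrite /= sx.
Qed.

Lemma grid_sumD As p q :
  grid_sum As (fun x => p x + q x) = grid_sum As p + grid_sum As q.
Proof.
elim: As p q => [|A As IH] p q //=.
by rewrite -big_split /=; apply: eq_bigr => a _; rewrite IH mulrDr.
Qed.

Lemma grid_sumZ As c p : grid_sum As (fun x => c * p x) = c * grid_sum As p.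
Proof.
elim: As p => [|A As IH] p //=.
by rewrite big_distrr /=; apply: eq_bigr => a _; rewrite IH mulrCA.
Qed.

Lemma grid_sum_neq0 As p : grid_sum As p != 0 ->
  exists x, [/\ size x = size As, all2 (fun a A => a \in A) x As & p x != 0].
Proof.
elim: As p => [|A As IH] p /= h; first by exists [::].
have [a aA ha] : exists2 a, a \in A & grid_sum As (fun x => p (a :: x)) != 0.
  apply/hasP; apply: contraNT h => /hasPn h; rewrite big_seq big1 // => a aA.
  by have := h a aA; rewrite negbK => /eqP ->; rewrite mulr0.
have [x [sx xA px]] := IH _ ha.
by exists (a :: x); split=> //=; rewrite ?sx ?aA.
Qed.

Definition grid_for (t : seq nat) (As : seq (seq F)) : bool :=
  all2 (fun k A => (size A == k.+1) && uniq A) t As.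

Lemma grid_for_size t As : grid_for t As -> size As = size t.
Proof. by rewrite /grid_for all2E => /andP[/eqP ->]. Qed.

(** If [b] differs from [t] without having a larger sum, some exponent of [b] is below its target,
    and the divided difference in that variable kills the monomial. Hence [grid_sum] reads off the
    coefficient of [mono t] in polynomials of total degree at most [sumn t]. *)
Lemma grid_sum_mono t As b : grid_for t As -> size b = size t ->
  (sumn b <= sumn t)%N -> grid_sum As (mono b) = (b == t)%:R.
Proof.
elim: t As b => [|k t IH] [|A As] [|j b] //= /andP[/andP[/eqP sA uA] gA] [sb] le.
have -> : \sum_(a <- A) lagrange_weight A a * grid_sum As (fun x => a ^+ j * mono b x)
   = (\sum_(a <- A) lagrange_weight A a * a ^+ j) * grid_sum As (mono b).
  by rewrite big_distrl /=; apply: eq_bigr => a _; rewrite grid_sumZ mulrA.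
case: (ltngtP j k) => [jk|jk|jk].
- by rewrite (lagrange_weight_sum uA sA (ltnW jk)) ltn_eqF // mul0r eqseq_cons ltn_eqF.
- have lt : (sumn b < sumn t)%N by rewrite -(ltn_add2l k) (leq_trans _ le) // ltn_add2r.
  rewrite (IH As b) ?(ltnW lt) // eqseq_cons gtn_eqF //=.
  by case: eqP => [eb|_]; [rewrite eb ltnn in lt | rewrite mulr0].
- rewrite jk (lagrange_weight_sum uA sA) // eqxx mul1r eqseq_cons eqxx /=.
  by apply: IH => //; rewrite jk leq_add2l in le.
Qed.

Lemma mono_incr b x i : (i < size b)%N -> size x = size b ->
  mono (incr_nth b i) x = nth 0 x i * mono b x.
Proof.
elim: b x i => [|k b IH] [|a x] [|i] //= ib [sx]; first by rewrite exprS mulrA.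
by rewrite IH // mulrCA.
Qed.

End Nullstellensatz.

(* A linear form with coefficients [1] (flag [false]) and [-1] (flag [true]). *)
Definition form := seq (bool * nat).

Definition eval_form (R : nzRingType) (f : form) (x : seq R) : R :=
  foldr (fun p s => (if p.1 then - x`_p.2 else x`_p.2) + s) 0 f.

(** The coefficient of [mono t] in [mono b] times the product of [fs], expanded one form at a time.
    A branch is cut as soon as an exponent would exceed its target in [t], to keep the evaluation
    small. *)
Fixpoint form_coef (t : seq nat) (fs : seq form) (b : seq nat) : int :=
  if fs is f :: fs' then
    foldr (fun p s => (if (nth 0%N t p.2 <= nth 0%N b p.2)%N then 0 else
       if p.1 then - form_coef t fs' (incr_nth b p.2)
       else form_coef t fs' (incr_nth b p.2)) + s) 0 f
  else (b == t)%:R.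

(** Exponents only grow during the expansion, so the cut branches contribute nothing. *)
Lemma form_coef_overflow t fs b i :
  (nth 0%N t i < nth 0%N b i)%N -> form_coef t fs b = 0.
Proof.
elim: fs b => [|f fs IH] b lt /=.
  by case: eqP lt => [->|//]; rewrite ltnn.
have h j : form_coef t fs (incr_nth b j) = 0.
  by apply: IH; rewrite nth_incr_nth (leq_trans lt) // leq_addl.
elim: f {lt} => //= p f ->; rewrite h addr0.
by case: ifP => // _; case: p.1; rewrite ?oppr0.
Qed.

Lemma sumn_incr_nth b i : sumn (incr_nth b i) = (sumn b).+1.
Proof.
elim: b i => [|k b IH] [|i] //=; last by rewrite IH addnS.
by rewrite sumn_ncons mul0n.
Qed.

(** Too few forms remain to reach the degree of [t]; this is what removes the constants below. *)
Lemma form_coef_underflow t fs b :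
  (sumn b + size fs < sumn t)%N -> form_coef t fs b = 0.
Proof.
elim: fs b => [|f fs IH] b lt /=.
  by case: eqP lt => [->|//]; rewrite addn0 ltnn.
have h j : form_coef t fs (incr_nth b j) = 0.
  by apply: IH; rewrite sumn_incr_nth addSnnS.
elim: f {lt} => //= p f ->; rewrite h addr0.
by case: ifP => // _; case: p.1; rewrite ?oppr0.
Qed.

Definition vars_lt (n : nat) (f : form) : bool := all (fun p => p.2 < n)%N f.

(** Expand the first factor: taking its constant leaves total degree below [sumn t], so only its
    linear part contributes. *)
Lemma grid_sum_forms (F : fieldType) t (As : seq (seq F)) (fs : seq (form * F)) b :
    grid_for t As -> size b = size t -> all (vars_lt (size t)) (map fst fs) ->
    (sumn b + size fs <= sumn t)%N ->
  grid_sum As (fun x => mono b x * \prod_(f <- fs) (eval_form f.1 x - f.2))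
    = (form_coef t (map fst fs) b)%:~R.
Proof.
move=> gA; elim: fs b => [|[f c] fs IH] b sb /= vf le.
  rewrite addn0 in le.
  rewrite (eq_grid_sum (q := mono b)) => [|x _]; last by rewrite big_nil mulr1.
  by rewrite (grid_sum_mono gA) //; case: (b == t).
case/andP: vf => vf vfs.
pose P (x : seq F) := \prod_(g <- fs) (eval_form g.1 x - g.2).
rewrite (eq_grid_sum (q := fun x => mono b x * eval_form f x * P x +
    (- c) * (mono b x * P x))) => [|x _]; last first.
  by rewrite big_cons /= -/(P x) !mulrDl !mulrDr mulrA mulrA (mulrC (mono b x) (- c)) mulrA.
rewrite grid_sumD grid_sumZ IH //; last by rewrite (leq_trans _ le) // leq_add2l.
rewrite form_coef_underflow ?mulr0 ?addr0; last first.
  by rewrite size_map (leq_trans _ le) // addnS.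
elim: f vf => [|[s i] f IHf] /=.
  rewrite (eq_grid_sum (q := fun x => 0 * mono b x)) ?grid_sumZ ?mul0r //.
  by move=> x _; rewrite mulr0 !mul0r.
case/andP=> ib vf; rewrite intrD -IHf // (eq_grid_sum (q := fun x =>
   (-1) ^+ s * (mono (incr_nth b i) x * P x) + mono b x * eval_form f x * P x)); last first.
  move=> x sx; rewrite mono_incr ?sb // ?sx ?(grid_for_size gA) //.
  rewrite mulrDr mulrDl; congr (_ + _); case: s => /=.
    by rewrite expr1 mulN1r !mulrN !mulNr (mulrC (mono b x)).
  by rewrite expr0 mul1r (mulrC (mono b x)).
rewrite grid_sumD grid_sumZ IH ?size_incr_nth ?sb ?ib //; last first.
  by rewrite sumn_incr_nth addSnnS.
congr (_ + _); case: ifP => [ge|_].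
  rewrite (@form_coef_overflow _ _ _ i) ?mulr0 // nth_incr_nth eqxx add1n ltnS //.
by case: s => /=; rewrite ?expr1 ?expr0 ?mul1r // mulN1r rmorphN.
Qed.

Lemma eval_form_nat (f : form) (x : seq nat) :
  eval_form f [seq (k%:R : rat) | k <- x] = (eval_form f [seq (k%:R : int) | k <- x])%:~R.
Proof.
elim: f => //= -[s i] f -> /=; rewrite intrD; congr (_ + _).
have [ix|ix] := ltnP i (size x).
  by rewrite !(nth_map 0%N) //; case: s; rewrite ?rmorphN /= natz -pmulrn.
by rewrite !nth_default ?size_map //; case: s; rewrite ?oppr0.
Qed.

(** The coefficient is an integer, and over the rationals it equals the [grid_sum] of the product.
    As it is nonzero, the product is nonzero at some grid point, where every form avoids its
    value. *)
Lemma combinatorial_nullstellensatz (t : seq nat) (As : seq (seq nat))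
    (fs : seq (form * int)) :
    all2 (fun k A => (k < size A)%N && uniq A) t As ->
    all (vars_lt (size t)) (map fst fs) -> size fs = sumn t ->
    form_coef t (map fst fs) (nseq (size t) 0%N) != 0 ->
  exists x : seq nat, [/\ size x = size t, all2 (fun k A => k \in A) x As &
    forall f, f \in fs -> eval_form f.1 [seq (k%:R : int) | k <- x] != f.2].
Proof.
move=> tA vf sf nz.
(* The lists may be too long, whereas [grid_for] wants exactly one point more than the exponent. *)
pose Bs := [seq take p.1.+1 p.2 | p <- zip t As].
pose As' := [seq [seq (k%:R : rat) | k <- A] | A <- Bs].
pose fs' := [seq (f.1, (f.2%:~R : rat)) | f <- fs].
have ef : map fst fs' = map fst fs by rewrite /fs' -map_comp.
have gA : grid_for t As'.
  rewrite /As' /Bs /grid_for; elim: (t) (As) tA => [|k u IH] [|A Cs] //=.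
  case/andP=> /andP[kA uA] /IH ->; rewrite size_map size_takel // eqxx andbT /=.
  by rewrite map_inj_in_uniq ?take_uniq // => y z _ _ /eqP; rewrite eqr_nat => /eqP.
have := @grid_sum_forms _ t As' fs' (nseq (size t) 0%N) gA.
rewrite size_nseq ef size_map sf sumn_nseq mul0n add0n => /(_ erefl vf (leqnn _)).
set p := (fun x => _) => e.
have /grid_sum_neq0[y [sy yA py]] : grid_sum As' p != 0 by rewrite e intr_eq0.
have [x sx xA] : exists2 x : seq nat, y = [seq k%:R | k <- x] & all2 (fun k A => k \in A) x As.
  move: yA {py e gA sy}; rewrite /As' /Bs; elim: (t) (As) y tA => [|k u IH] [|A Cs] [|a y] //=.
    by exists [::].
  case/andP=> _ tA /andP[/mapP[m mA ->] /(IH _ _ tA)[x -> xA]].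
  by exists (m :: x) => //=; rewrite (mem_take mA).
exists x; split=> //.
  by rewrite -(size_map (fun k => k%:R : rat)) -sx sy (grid_for_size gA).
move=> f fin; move: py; rewrite /p mulf_eq0 negb_or => /andP[_].
rewrite prodf_seq_neq0 => /allP /(_ (f.1, f.2%:~R)) /=.
rewrite sx eval_form_nat subr_eq0 eqr_int; apply.
by apply/mapP; exists f.
Qed.

(** * Constraints of a star *)

Definition distinct_forms (n : nat) : seq (form * int) :=
  flatten [seq [seq ([:: (false, i); (true, j)], 0) | j <- iota 0 i] | i <- iota 0 n].

Lemma mem_cat3 (I : eqType) (x : I) (a b c : seq I) :
  (x \in a ++ b ++ c) = [|| x \in a, x \in b | x \in c].
Proof. by rewrite !mem_cat. Qed.

Lemma mem_distinct_forms n i j : (j < i)%N -> (i < n)%N ->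
  ([:: (false, i); (true, j)], 0) \in distinct_forms n.
Proof.
move=> ji ltin; apply/flatten_mapP; exists i; first by rewrite mem_iota.
by apply/mapP; exists j => //; rewrite mem_iota.
Qed.

Definition sum_form (n : nat) : form := [seq (false, i) | i <- iota 0 n].

(* Constraints on the colour [a] of a 4-vertex [x] adjacent to the centre of the star, where
   [e] is the colour of the edge to the centre: [a] differs from the colour of the centre and
   from [e], and the sum at [x] differs from the sums at its three other neighbours (constants
   [cs]) and from the sum at the centre (constant [d]). *)
Definition four_forms (t q k : nat) (cs : seq int) (d : int) : seq (form * int) :=
  let e := (t + k).+1 in let a := (t + q + k).+1 in
  [:: ([:: (false, a); (true, 0%N)], 0); ([:: (false, a); (true, e)], 0)]
  ++ [seq ([:: (false, a); (false, e)], c) | c <- cs]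
  ++ [:: ((false, a) :: [seq (true, i) | i <- iota 0 (t + q).+1 & i != e], d)].

(* Variable [0] is the colour of the centre [v]; variables [1 .. t] are the colours of edges
   from [v] to vertices of degree at most 3; variables [t + 1 .. t + q] are the colours of
   edges from [v] to 4-vertices, and the last [q] variables are the colours of these. *)
Definition star_forms (t q : nat) (cS : seq int) (cs : nat -> seq int) (d : nat -> int)
    : seq (form * int) :=
  distinct_forms (t + q).+1
  ++ flatten [seq four_forms t q k (cs k) (d k) | k <- iota 0 q]
  ++ [seq (sum_form (t + q).+1, c) | c <- cS].

(** The constants are set to 0: the top coefficient depends only on how many constraints of each
    kind there are, so one computation serves all colourings. *)
Definition star_coef (t q M : nat) (b : seq nat) : int :=
  form_coef b (map fst (star_forms t q (nseq M 0) (fun=> nseq 3 0) (fun=> 0)))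
    (nseq (t + q + q).+1 0%N).

Definition star_ok (t q M : nat) (b : seq nat) : bool :=
  [&& size b == (t + q + q).+1,
      sumn b == size (star_forms t q (nseq M 0) (fun=> nseq 3 0) (fun=> 0)) &
      star_coef t q M b != 0].

Lemma eval_form_cons (R : nzRingType) p f (x : seq R) :
  eval_form (p :: f) x = (if p.1 then - x`_p.2 else x`_p.2) + eval_form f x.
Proof. by []. Qed.

Lemma eval_sum_form (x : seq nat) n : (n <= size x)%N ->
  eval_form (sum_form n) [seq (k%:R : int) | k <- x] = (\sum_(i < n) nth 0%N x i)%N%:R.
Proof.
move=> nx; rewrite /eval_form /sum_form foldr_map /= natr_sum.
rewrite -(big_mkord predT (fun i => (nth 0%N x i)%:R : int)) unlock /reducebig.
rewrite /index_iota subn0; have : all (gtn n) (iota 0 n).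
  by apply/allP=> i; rewrite mem_iota.
elim: (iota 0 n) => //= i s IH /andP[ins /IH ->].
by rewrite (nth_map 0%N) // (leq_trans ins).
Qed.

(** Index [e] is left out because the edge from the centre to the 4-vertex contributes to both sums
    and cancels in their difference. *)
Lemma eval_rest_form (x : seq nat) n e : (n <= size x)%N -> (e < n)%N ->
  eval_form [seq (true, i) | i <- iota 0 n & i != e] [seq (k%:R : int) | k <- x]
    = (nth 0%N x e)%:R - (\sum_(i < n) nth 0%N x i)%N%:R.
Proof.
move=> nx en; rewrite (bigD1 (Ordinal en)) //= natrD opprD addNKr.
rewrite /eval_form foldr_map /= natr_sum.
rewrite -(big_mkord (fun i => i != e) (fun i => (nth 0%N x i)%:R : int)).
rewrite -[RHS]sumrN -big_filter.
rewrite unlock /reducebig /index_iota subn0.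
have : all (gtn n) [seq i <- iota 0 n | i != e].
  by apply/allP=> i; rewrite mem_filter mem_iota => /andP[].
elim: [seq _ <- _ | _] => //= i s IH /andP[ins /IH ->].
by rewrite (nth_map 0%N) // (leq_trans ins).
Qed.

Lemma map_fst_star_forms t q cS cs d cS' cs' d' :
    size cS = size cS' -> (forall k, (k < q)%N -> size (cs k) = size (cs' k)) ->
  map fst (star_forms t q cS cs d) = map fst (star_forms t q cS' cs' d').
Proof.
have mapc (f : form) (c c' : seq int) : size c = size c' ->
    map fst [seq (f, j) | j <- c] = map fst [seq (f, j) | j <- c'].
  by elim: c c' => [|a c IH] [|a' c'] //= [/IH ->].
move=> sS ss; rewrite /star_forms !map_cat !map_flatten.
congr (_ ++ (flatten _ ++ _)); last exact: mapc.
rewrite -!map_comp; apply/eq_in_map=> k; rewrite mem_iota add0n => /andP[_ kq] /=.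
by rewrite /four_forms !map_cat (mapc _ _ _ (ss k kq)).
Qed.

Lemma star_forms_vars t q cS cs d :
  all (vars_lt (t + q + q).+1) (map fst (star_forms t q cS cs d)).
Proof.
rewrite all_map; apply/allP=> f; rewrite mem_cat3 => /or3P[].
- case/flatten_mapP=> i; rewrite mem_iota => /andP[_ hi] /mapP[j].
  rewrite mem_iota => /andP[_ hj] -> /=; rewrite /vars_lt /= !andbT; lia.
- case/flatten_mapP=> k; rewrite mem_iota => /andP[_ hk].
  rewrite mem_cat3 => /or3P[].
  + rewrite !inE => /orP[] /eqP -> /=; rewrite /vars_lt /= !andbT; lia.
  + case/mapP=> c _ -> /=; rewrite /vars_lt /= !andbT; lia.
  + rewrite inE => /eqP -> /=; rewrite /vars_lt /= all_map; apply/andP; split; first by lia.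
    by apply/allP=> i; rewrite mem_filter mem_iota /= => /and3P[]; lia.
- case/mapP=> c _ -> /=; rewrite /vars_lt /sum_form all_map.
  by apply/allP=> i; rewrite mem_iota /=; lia.
Qed.

Lemma star_solution t q M b (cS : seq int) (cs : nat -> seq int) (d : nat -> int) (A : nat -> seq nat) :
    star_ok t q M b -> size cS = M -> (forall k, (k < q)%N -> size (cs k) = 3) ->
    (forall i, (i < (t + q + q).+1)%N -> (nth 0%N b i < size (A i))%N && uniq (A i)) ->
  exists x : nat -> nat,
  [/\ forall i, (i < (t + q + q).+1)%N -> x i \in A i,
      forall i j, (i < (t + q).+1)%N -> (j < (t + q).+1)%N -> i != j -> x i != x j,
      forall c, c \in cS -> (\sum_(i < (t + q).+1) x i)%N%:R != c :> int &
      forall k, (k < q)%N -> let e := x (t + k).+1 in let a := x (t + q + k).+1 in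
      [/\ a != x 0%N, a != e, forall c, c \in cs k -> (a + e)%N%:R != c :> int &
       (a + e)%N%:R - (\sum_(i < (t + q).+1) x i)%N%:R != d k]].
Proof.
case/and3P=> /eqP sb /eqP sumb nz sS ss hA.
have em : map fst (star_forms t q cS cs d)
    = map fst (star_forms t q (nseq M 0) (fun=> nseq 3 0) (fun=> 0)).
  by apply: map_fst_star_forms => [|k kq]; rewrite size_nseq // ss.
have [||||x [sx xA xf]] :=
    @combinatorial_nullstellensatz b (mkseq A (t + q + q).+1) (star_forms t q cS cs d).
- rewrite all2E size_mkseq sb eqxx andTb; apply/(all_nthP (0%N, [::])) => i.
  rewrite size_zip size_mkseq sb minnn => hi.
  by rewrite nth_zip ?size_mkseq // nth_mkseq //= hA.
- by rewrite em sb star_forms_vars.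
- by rewrite -(size_map fst) em size_map.
- by rewrite em sb; exact: nz.
exists (nth 0%N x); rewrite sb in sx.
have ev s i : (i < size x)%N -> (if s then - [seq (k%:R : int) | k <- x]`_i
     else [seq (k%:R : int) | k <- x]`_i) = if s then - (nth 0%N x i)%:R else (nth 0%N x i)%:R.
  by move=> ix; rewrite (nth_map 0%N).
split.
- move=> i hi; move: xA; rewrite all2E size_mkseq sx eqxx => /(all_nthP (0%N, [::])) /(_ i).
  by rewrite size_zip size_mkseq sx minnn nth_zip ?size_mkseq // nth_mkseq //= => ->.
- have h i j : (j < i)%N -> (i < (t + q).+1)%N -> nth 0%N x i != nth 0%N x j.
    move=> ji hi; have := xf ([:: (false, i); (true, j)], 0).
    rewrite /eval_form /= !(nth_map 0%N) ?sx ?addr0 ?subr_eq0 ?eqr_nat; try lia.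
    by apply; rewrite mem_cat3 mem_distinct_forms.
  by move=> i j hi hj; rewrite neq_ltn => /orP[] ij; [rewrite eq_sym|]; apply: h.
- move=> c hc; have := xf (sum_form (t + q).+1, c).
  rewrite [_.1]/= eval_sum_form ?sx ?ltnS ?leq_addr //; apply.
  by rewrite mem_cat3; apply/or3P; apply: Or33; apply: map_f.
- move=> k kq /=.
  have hk f : f \in four_forms t q k (cs k) (d k) -> f \in star_forms t q cS cs d.
    move=> hf; rewrite mem_cat3; apply/or3P; apply: Or32.
    by apply/flatten_mapP; exists k => //; rewrite mem_iota add0n; lia.
  split.
  + have := xf _ (hk ([:: (false, (t + q + k).+1); (true, 0%N)], 0) _).
    rewrite /eval_form /= !(nth_map 0%N) ?sx ?addr0 ?subr_eq0 ?eqr_nat; try lia.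
    by apply; rewrite !inE eqxx.
  + have := xf _ (hk ([:: (false, (t + q + k).+1); (true, (t + k).+1)], 0) _).
    rewrite /eval_form /= !(nth_map 0%N) ?sx ?addr0 ?subr_eq0 ?eqr_nat; try lia.
    by apply; rewrite !inE eqxx orbT.
  + move=> c hc.
    have := xf _ (hk ([:: (false, (t + q + k).+1); (false, (t + k).+1)], c) _).
    rewrite /eval_form /= !(nth_map 0%N) ?sx ?addr0 ?natrD; try lia.
    by apply; rewrite mem_cat3; apply/or3P; apply: Or32; apply: map_f.
  + have hin : ((false, (t + q + k).+1) ::
       [seq (true, i) | i <- iota 0 (t + q).+1 & i != (t + k).+1], d k)
       \in four_forms t q k (cs k) (d k).
      by rewrite mem_cat3; apply/or3P; apply: Or33; rewrite inE.
    have : eval_form ((false, (t + q + k).+1) ::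
       [seq (true, i) | i <- iota 0 (t + q).+1 & i != (t + k).+1])
       [seq (k%:R : int) | k <- x] != d k := xf _ (hk _ hin).
    rewrite eval_form_cons eval_rest_form ?sx ?ltnS ?leq_addr //; last by lia.
    rewrite (nth_map 0%N) ?sx; last by rewrite /=; lia.
    by rewrite natrD addrA.
Qed.

(* The exponent vectors were found by a computer search. *)
Lemma star_ok_1_0_4 : star_ok 1 0 4 [:: 1; 4].
Proof. by vm_compute. Qed.
Lemma star_ok_4_0_5 : star_ok 4 0 5 [:: 1; 5; 2; 3; 4].
Proof. by vm_compute. Qed.
Lemma star_ok_1_0_1 : star_ok 1 0 1 [:: 2; 0].
Proof. by vm_compute. Qed.
Lemma star_ok_1_1_1 : star_ok 1 1 1 [:: 3; 2; 1; 4].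
Proof. by vm_compute. Qed.
Lemma star_ok_3_1_4 : star_ok 3 1 4 [:: 1; 5; 3; 4; 3; 4].
Proof. by vm_compute. Qed.
Lemma star_ok_2_1_4 : star_ok 2 1 4 [:: 0; 5; 4; 3; 4].
Proof. by vm_compute. Qed.
Lemma star_ok_1_1_4 : star_ok 1 1 4 [:: 2; 4; 3; 4].
Proof. by vm_compute. Qed.
Lemma star_ok_0_2_3 : star_ok 0 2 3 [:: 4; 2; 4; 4; 4].
Proof. by vm_compute. Qed.
Lemma star_ok_0_1_3 : star_ok 0 1 3 [:: 4; 2; 4].
Proof. by vm_compute. Qed.
Lemma star_ok_3_0_4 : star_ok 3 0 4 [:: 1; 4; 3; 2].
Proof. by vm_compute. Qed.
Lemma star_ok_2_0_4 : star_ok 2 0 4 [:: 1; 4; 2].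
Proof. by vm_compute. Qed.

End Algebra.

(** * Recolouring a star *)

Definition avoid (K : nat) (bad : seq nat) : seq nat :=
  [seq k <- iota 1 K | k \notin bad].

Lemma mem_avoid K bad k :
  (k \in avoid K bad) = [&& 1 <= k <= K & k \notin bad].
Proof. by rewrite mem_filter mem_iota add1n ltnS andbC. Qed.

Lemma uniq_avoid K bad : uniq (avoid K bad).
Proof. by rewrite filter_uniq ?iota_uniq. Qed.

Lemma size_avoid K bad : K <= size (avoid K bad) + size bad.
Proof.
rewrite -{1}(size_iota 1 K) -(count_predC (mem bad)) addnC leq_add //.
  by rewrite size_filter.
rewrite -size_filter; apply: uniq_leq_size; first by rewrite filter_uniq ?iota_uniq.
by move=> k; rewrite mem_filter => /andP[].
Qed.

Section Extension.
Variables (T : finType) (g : rel T) (K : nat).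
Hypotheses (gsym : symmetric g) (girr : irreflexive g).

Definition edge_ok (ce : T -> T -> nat) : Prop :=
  [/\ forall u v, g u v -> 1 <= ce u v <= K,
      forall u v, g u v -> ce u v = ce v u &
      forall u v w, g u v -> g u w -> v != w -> ce u v != ce u w].

(** Only vertices of [W] count as coloured. Since the sum at a vertex involves no other vertex
    colour, values of [cv] outside [W] enter no constraint. *)
Definition vertex_ok (cv : T -> nat) (ce : T -> T -> nat) (W : {set T}) : Prop :=
  forall u, u \in W ->
  [/\ 1 <= cv u <= K, forall v, g u v -> ce u v != cv u &
      forall v, v \in W -> g u v ->
        cv u != cv v /\ colour_sum g cv ce u != colour_sum g cv ce v].

(* A vertex of degree at most 3 sees at most 3 colours on its neighbours, 3 on its edges, and
   has to avoid at most 3 sums. *)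
Lemma colour_small_vertices cv ce W :
    9 < K -> edge_ok ce -> vertex_ok cv ce W ->
    (forall w, w \notin W -> deg g w <= 3) ->
  tnsd_index_le g K.
Proof.
move=> K9 eok.
have [n le] := ubnP #|~: W|; elim: n W cv le => // n IH W cv le vok small.
have [W0|[u]] := set_0Vmem (~: W).
  exists cv, ce; have inW w : w \in W.
    by apply: contraT => hw; have : w \in ~: W by [rewrite inE]; rewrite W0 inE.
  case: eok => e1 e2 e3; split.
    split; first by move=> w; case: (vok w (inW w)).
    split=> //; split=> //; split.
      by move=> a b ab; case: (vok a (inW a)) => _ _ /(_ b (inW b) ab)[].
    by split=> // a b ab; case: (vok a (inW a)) => _ /(_ b ab).
  by move=> a b ab; case: (vok a (inW a)) => _ _ /(_ b (inW b) ab)[].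
rewrite inE => uW; have du := small u uW.
pose N := enum [set w | g u w].
have sN : size N <= 3 by rewrite -cardE.
have mN w : (w \in N) = g u w by rewrite mem_enum inE.
(* Truncated subtraction is harmless: when the sums at [u] and [w] agree, the colour of [u] is
   exactly this difference. *)
pose bad := [seq cv w | w <- N] ++ [seq ce u w | w <- N] ++
  [seq colour_sum g cv ce w - \sum_(y | g u y) ce u y | w <- N].
have : 0 < size (avoid K bad).
  by have := size_avoid K bad; rewrite !size_cat !size_map; lia.
case: (avoid K bad) (mem_avoid K bad) => // k s hk _.
have := hk k; rewrite inE eqxx => /esym /andP[kK].
rewrite !mem_cat !negb_or => /and3P[k1 k2 k3].
pose cv' w := if w == u then k else cv w.
have cs w : w != u -> colour_sum g cv' ce w = colour_sum g cv ce w.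
  by move=> wu; rewrite /colour_sum /cv' (negbTE wu).
have cu : colour_sum g cv' ce u = k + \sum_(y | g u y) ce u y.
  by rewrite /colour_sum /cv' eqxx.
have hu w : g u w -> [/\ k != cv w, ce u w != k & colour_sum g cv' ce u != colour_sum g cv ce w].
  move=> uw; have wN : w \in N by rewrite mN.
  split; [apply: contraNneq k1 => -> | apply: contraNneq k2 => <- | apply: contraNneq k3 => e].
  - exact: map_f.
  - exact: map_f.
  - by apply/mapP; exists w => //; rewrite -e cu addnK.
apply: (IH (u |: W) cv').
- rewrite ltnS in le; apply: leq_trans le; apply: proper_card.
  apply/properP; split; first by rewrite setCS subsetUr.
  by exists u; rewrite !inE ?eqxx.
- have neu w : w \in W -> w != u by apply: contraTneq => ->.
  move=> a; rewrite in_setU1 => /orP[/eqP ->|aW].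
    split; first by rewrite /cv' eqxx.
      by move=> b ub; rewrite /cv' eqxx; case: (hu b ub).
    move=> b; rewrite in_setU1 => /orP[/eqP ->|bW] ub; first by rewrite girr in ub.
    case: (hu b ub) => h1 _ h3; rewrite {1 2}/cv' eqxx (negbTE (neu b bW)); split=> //.
    by rewrite (cs b) ?neu.
  case: (vok a aW) => v1 v2 v3; have ua := neu a aW.
  split; first by rewrite /cv' (negbTE ua).
    by move=> b ab; rewrite /cv' (negbTE ua) v2.
  move=> b; rewrite in_setU1 => /orP[/eqP ->|bW] ab.
    have [h1 _ h3] := hu a (etrans (gsym _ _) ab).
    by rewrite {1 2}/cv' eqxx (negbTE ua) (cs a) // eq_sym h1 eq_sym h3.
  by rewrite !cs ?neu // /cv' !(negbTE (neu _ _)) //; exact: v3.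
- by move=> w; rewrite in_setU1 negb_or => /andP[_]; apply: small.
Qed.

Definition del_star (v : T) (s : seq T) : rel T := fun a b =>
  [&& g a b, ~~ ((a == v) && (b \in s)) & ~~ ((b == v) && (a \in s))].

(** Here [gam], [fe] and [al] are the new colours of [v], of the deleted edges and of the 4-vertices
    [xs], while [sv] and [sx] are the resulting sums. Deleted edges join [v] to [s], so sums
    elsewhere are unchanged. The vertices of [us] need no colours here, being small and coloured
    last. *)
Lemma recolour_star v us xs cv ce gam (fe al : T -> nat) :
    let s := us ++ xs in
    let h := del_star v s in
    let sv := gam + \sum_(w <- s) fe w + \sum_(w | g v w && (w \notin s)) ce v w in
    let sx x := al x + fe x + \sum_(y | g x y && (y != v)) ce x y in
    9 < K -> uniq s -> {in s, forall w, g v w} -> {in us, forall u, deg g u <= 3} ->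
    {in xs &, forall x y, ~~ g x y} ->
    tnsd_colouring h K cv ce ->
    1 <= gam <= K ->
    (forall w, g v w -> w \notin s -> ce v w != gam) ->
    (forall w, g v w -> 3 < deg g w -> w \notin xs ->
       gam != cv w /\ sv != colour_sum h cv ce w) ->
    {in s, forall b, [/\ 1 <= fe b <= K, fe b != gam,
       forall w, g v w -> w \notin s -> fe b != ce v w &
       forall y, g b y -> y != v -> fe b != ce b y]} ->
    {in s &, injective fe} ->
    {in xs, forall x, [/\ 1 <= al x <= K, al x != gam, al x != fe x, sx x != sv &
       forall y, g x y -> y != v ->
       [/\ al x != cv y, ce x y != al x & sx x != colour_sum h cv ce y]]} ->
  tnsd_index_le g K.
Proof.
move=> s h sv sx K9 us_ sN small indep [[c1 [c2 [c3 [c4 [c5 c6]]]]] c7] gK gE gW fS finj aX.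
pose cv' w := if w == v then gam else if w \in xs then al w else cv w.
pose ce' a b := if (a == v) && (b \in s) then fe b else
  if (b == v) && (a \in s) then fe a else ce a b.
have vs : v \notin s by apply/negP=> /sN; rewrite girr.
have sxs x : x \in xs -> x \in s by rewrite mem_cat orbC => ->.
have vxs : v \notin xs by apply: contra vs; apply: sxs.
have xv x : x \in s -> (x == v) = false by move=> xs_; apply/negbTE; apply: contraNneq vs => <-.
have hE a b : g a b -> ~~ ((a == v) && (b \in s)) -> ~~ ((b == v) && (a \in s)) -> h a b.
  by rewrite /h /del_star => -> -> ->.
have ce'v w : w \in s -> ce' v w = fe w by rewrite /ce' eqxx => ->.
have ce'v' w : w \notin s -> ce' v w = ce v w.
  by move=> ws; rewrite /ce' eqxx (negbTE ws) (negbTE vs) !andbF.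
have ce's b : b \in s -> ce' b v = fe b by move=> bs; rewrite /ce' bs eqxx xv.
have ce'o a b : a != v -> b != v -> ce' a b = ce a b.
  by move=> /negbTE av /negbTE bv; rewrite /ce' av bv.
have ce'o2 a b : a != v -> a \notin s -> ce' a b = ce a b.
  by move=> /negbTE av /negbTE as_; rewrite /ce' av as_ andbF.
have eok : edge_ok ce'.
  have sy a b : g a b -> ce' a b = ce' b a.
    have [->|av] := eqVneq a v.
      have [bs|bs] := boolP (b \in s); first by rewrite ce'v ?ce's.
      move=> vb; have bv : b != v by apply: contraTneq vb => ->; rewrite girr.
      by rewrite ce'v' // ce'o2 // c3 // hE // ?negb_and ?bs ?vs ?orbT.
    have [->|bv] := eqVneq b v.
      have [as_|as_] := boolP (a \in s); first by rewrite ce'v ?ce's.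
      by move=> ab; rewrite ce'v' // ce'o2 // c3 // hE // negb_and ?as_ ?vs ?orbT.
    by move=> ab; rewrite !ce'o // c3 // hE // negb_and ?av ?bv.
  split=> //.
    have rg b : g v b -> 1 <= ce' v b <= K.
      move=> vb; have [bs|bs] := boolP (b \in s); first by rewrite ce'v //; case: (fS b bs).
      by rewrite ce'v' // c2 // hE // negb_and ?bs ?vs ?orbT.
    move=> a b; have [->|av] := eqVneq a v; first exact: rg.
    have [-> ab|bv ab] := eqVneq b v; first by rewrite sy // rg // gsym.
    by rewrite ce'o // c2 // hE // negb_and ?av ?bv.
  move=> a b c; have [->|av] := eqVneq a v.
    move=> vb vc bc; have [bs|bs] := boolP (b \in s); have [cs|cs] := boolP (c \in s).
    - by rewrite !ce'v //; apply: contra_neq bc; apply: finj.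
    - by rewrite ce'v // ce'v' //; case: (fS b bs) => _ _ /(_ c vc cs).
    - by rewrite ce'v' // ce'v // eq_sym; case: (fS c cs) => _ _ /(_ b vb bs).
    - by rewrite !ce'v' // c5 // hE // negb_and ?bs ?cs ?vs ?orbT.
  have [as_|as_] := boolP (a \in s); last first.
    by move=> ab ac bc; rewrite !ce'o2 // c5 // hE // negb_and ?av ?as_ ?orbT.
  have [->|bv] := eqVneq b v => ab ac bc.
    have cv_ : c != v by rewrite eq_sym.
    by rewrite ce's // ce'o //; case: (fS a as_) => _ _ _ /(_ c ac cv_).
  have [cv_|cv_] := eqVneq c v.
    by rewrite cv_ ce's // ce'o // eq_sym; case: (fS a as_) => _ _ _ /(_ b ab bv).
  by rewrite !ce'o // c5 // hE // negb_and ?av ?bv ?cv_.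
have cs_v : colour_sum g cv' ce' v = sv.
  rewrite /colour_sum /cv' eqxx (bigID (mem s)) /= /sv -addnA; congr (_ + (_ + _)).
    rewrite [RHS]big_uniq //=; apply: eq_big => w; last by case/andP=> _ ws; rewrite ce'v.
    by apply: andb_idl => /sN.
  by apply: eq_bigr => w /andP[_ ws]; rewrite ce'v'.
have cs_x x : x \in xs -> colour_sum g cv' ce' x = sx x.
  move=> xx; have xs_ := sxs x xx; rewrite /colour_sum /cv' xv // xx /sx -addnA; congr (_ + _).
  rewrite (bigD1 v) /=; last by rewrite gsym sN.
  by rewrite ce's //; congr (_ + _); apply: eq_bigr => y /andP[_ yv]; rewrite ce'o // xv.
have cs_o w : w != v -> w \notin s -> colour_sum g cv' ce' w = colour_sum h cv ce w.
  move=> wv ws; have wx : w \notin xs by apply: contra ws; apply: sxs.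
  rewrite /colour_sum /cv' (negbTE wv) (negbTE wx); congr (_ + _); apply: eq_big => u.
    by rewrite /h /del_star (negbTE wv) (negbTE ws) andbF /= andbT.
  by move=> _; rewrite ce'o2.
(* The centre is kept whatever its degree; all other vertices of degree at most 3 are left to
   [colour_small_vertices]. *)
pose W := [set w | (3 < deg g w) || (w == v)].
have Ws w : w \in W -> w \notin xs -> w \notin s.
  rewrite inE => /orP[dw wx|/eqP ->//]; rewrite mem_cat (negbTE wx) orbF.
  by apply/negP=> /small; rewrite leqNgt dw.
pose Q a b := cv' a != cv' b /\ colour_sum g cv' ce' a != colour_sum g cv' ce' b.
have Qsym a b : Q a b -> Q b a by case=> q1 q2; split; rewrite eq_sym.
have Qv b : b \in W -> g v b -> Q v b.
  move=> bW vb; have bv : b != v by apply: contraTneq vb => ->; rewrite girr.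
  have [bx|bx] := boolP (b \in xs).
    by case: (aX b bx) => _ a1 _ a2 _; apply: Qsym; rewrite /Q cs_v cs_x // /cv' (negbTE bv) bx eqxx.
  have bs := Ws b bW bx; rewrite inE (negbTE bv) orbF in bW.
  by rewrite /Q cs_v cs_o // {1 2}/cv' eqxx (negbTE bv) (negbTE bx); apply: gW.
have Qx x b : x \in xs -> b \in W -> b != v -> g x b -> Q x b.
  move=> xx bW bv xb; have bx : b \notin xs by apply/negP=> bx; have := indep x b xx bx; rewrite xb.
  have bs := Ws b bW bx; case: (aX x xx) => _ _ _ _ /(_ b xb bv)[a1 _ a2].
  by rewrite /Q cs_x // cs_o // {1 2}/cv' xv ?sxs // xx (negbTE bv) (negbTE bx).
apply: (@colour_small_vertices cv' ce' W) => //; last first.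
  by move=> w; rewrite inE negb_or -leqNgt => /andP[].
move=> a aW; have [av|av] := eqVneq a v.
  split; first by rewrite /cv' av eqxx.
    move=> b; rewrite av /cv' eqxx => vb; have [bs|bs] := boolP (b \in s).
      by rewrite ce'v //; case: (fS b bs).
    by rewrite ce'v' // gE.
  by rewrite av => b bW /(Qv b bW).
have [ax|ax] := boolP (a \in xs).
  case: (aX a ax) => a1 a2 a3 _ a5; have as_ := sxs a ax.
  have ca : cv' a = al a by rewrite /cv' (negbTE av) ax.
  split; first by rewrite ca.
    move=> b ab; rewrite ca; have [->|bv] := eqVneq b v; first by rewrite ce's // eq_sym.
    by rewrite ce'o //; case: (a5 b ab bv).
  move=> b bW ab; have [bv|bv] := eqVneq b v; last exact: Qx.
  by rewrite bv; apply/Qsym/Qv; rewrite // -bv gsym.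
have as_ := Ws a aW ax.
have ca : cv' a = cv a by rewrite /cv' (negbTE av) (negbTE ax).
have ha b : g a b -> h a b by move=> ab; apply: hE; rewrite // negb_and ?av ?as_ ?orbT.
split; first by rewrite ca.
  by move=> b ab; rewrite ca ce'o2 // c6 // ha.
move=> b bW ab; have [bv|bv] := eqVneq b v.
  by rewrite bv; apply/Qsym/Qv; rewrite // -bv gsym.
have [bx|bx] := boolP (b \in xs); first by apply/Qsym/Qx; rewrite // gsym.
rewrite !cs_o // ?Ws // ca /cv' (negbTE bv) (negbTE bx).
by split; [apply: c4; apply: ha | apply: c7; apply: ha].
Qed.

End Extension.

(** * Reducibility of a star by counting available colours *)

Lemma card_del_star (T : finType) (g : rel T) v s :
    symmetric g -> 0 < size s -> {in s, forall w, g v w} ->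
  #|[set p : T * T | del_star g v s p.1 p.2]| < #|[set p : T * T | g p.1 p.2]|.
Proof.
move=> gsym; case: s => // w s _ sN; apply: proper_card; apply/properP; split.
  by apply/subsetP=> p; rewrite !inE => /and3P[].
by exists (v, w); rewrite !inE /= ?sN ?mem_head // /del_star eqxx mem_head andbF.
Qed.

(** The numeric hypotheses say that each list is longer than its exponent in [b]. The centre avoids
    at most [R] kept edges and [M] kept neighbours; a deleted edge avoids those [R] edges and the
    other edges at its far end; a 4-vertex avoids 3 neighbours and 3 edges, which leaves at least
    [D - 3] of the [D + 3] colours. *)
Lemma star_reducible (T : finType) (g : rel T) (D : nat) v us xs M R b :
    let s := us ++ xs in let t := size us in let q := size xs in
    symmetric g -> irreflexive g -> 8 <= D ->
    (forall h : rel T, simple_graph h -> (forall x y, h x y -> g x y) ->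
       #|[set p : T * T | h p.1 p.2]| < #|[set p : T * T | g p.1 p.2]| ->
       tnsd_index_le h (D + 3)) ->
    0 < size s -> uniq s -> {in s, forall w, g v w} ->
    {in us, forall u, deg g u <= 3} -> {in xs, forall x, deg g x = 4} ->
    {in xs &, forall x y, ~~ g x y} ->
    deg g v <= t + q + R ->
    #|[set w | [&& g v w, 3 < deg g w & w \notin xs]]| <= M ->
    star_ok t q M b ->
    nth 0 b 0 + R + M < D + 3 ->
    (forall i, i < t -> nth 0 b i.+1 + R + (deg g (nth v us i)).-1 < D + 3) ->
    (forall k, k < q -> nth 0 b (t + k).+1 + R < D /\ nth 0 b (t + q + k).+1 + 3 < D) ->
  tnsd_index_le g (D + 3).
Proof.
move=> s t q gsym girr D8 IH s0 us_ sN small four indep dv mM ok b0 bu bx.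
set K := D + 3.
have [||cv [ce col]] := IH (del_star g v s) _ _ (card_del_star gsym s0 sN).
- split=> [a c|a]; last by rewrite /del_star girr.
  by rewrite /del_star gsym; congr (_ && _); rewrite andbC.
- by move=> a c /andP[].
set h := del_star g v s in col.
have [[c1 [c2 [c3 [c4 [c5 c6]]]]] c7] := col.
pose Rs := enum [set w | g v w && (w \notin s)].
pose Ms := enum [set w | [&& g v w, 3 < deg g w & w \notin xs]].
pose Nb w := enum [set y | g w y && (y != v)].
have mRs w : (w \in Rs) = g v w && (w \notin s) by rewrite mem_enum inE.
have mMs w : (w \in Ms) = [&& g v w, 3 < deg g w & w \notin xs] by rewrite mem_enum inE.
have mNb w y : (y \in Nb w) = g w y && (y != v) by rewrite mem_enum inE.
have sMs : size Ms <= M by rewrite -cardE.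
have ss : size s = t + q by rewrite size_cat.
have sRs : size Rs <= R.
  rewrite -cardE -(leq_add2l (size s)) ss; apply: leq_trans dv.
  rewrite -ss -(card_uniqP us_) -cardUI [X in _ + X]eq_card0 ?addn0; last first.
    by move=> w; rewrite !inE; case: (w \in s); rewrite ?andbF.
  apply: subset_leq_card; apply/subsetP=> w; rewrite !inE => /orP[/sN //|].
  by case/andP.
have sNb w : w \in s -> size (Nb w) = (deg g w).-1.
  move=> ws; rewrite -cardE /deg (cardsD1 v [set u | g w u]) inE gsym sN //=.
  by apply: eq_card => y; rewrite !inE andbC.
have xs_s x : x \in xs -> x \in s by rewrite mem_cat orbC => ->.
have us_s x : x \in us -> x \in s by rewrite mem_cat => ->.
(* Variable 0 is the centre, so the edge of variable [i] goes to entry [i.-1] of [s]. *)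
pose A i := if i == 0 then avoid K (map cv Ms ++ map (ce v) Rs) else
  if i <= t + q then let w := nth v s i.-1 in avoid K (map (ce v) Rs ++ map (ce w) (Nb w))
  else let x := nth v xs (i - (t + q).+1) in avoid K (map cv (Nb x) ++ map (ce x) (Nb x)).
pose sgv := \sum_(w | g v w && (w \notin s)) ce v w.
pose sgx x := \sum_(y | g x y && (y != v)) ce x y.
(* [star_ok] is computed for exactly [M] sum constraints; padding with zeros only adds
   constraints. *)
pose cS := [seq (Posz (colour_sum h cv ce w) - Posz sgv)%R | w <- Ms] ++ nseq (M - size Ms) 0%R.
pose cs k := let x := nth v xs k in
  [seq (Posz (colour_sum h cv ce y) - Posz (sgx x))%R | y <- Nb x].
pose dk k := (Posz sgv - Posz (sgx (nth v xs k)))%R.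
have [|||x [xA xinj xS xX]] := @star_solution t q M b cS cs dk A ok.
- by rewrite size_cat size_map size_nseq subnKC.
- move=> k kq; have kx : nth v xs k \in xs by apply: mem_nth.
  by rewrite size_map sNb ?xs_s // four.
- move=> i hi; rewrite /A; case: eqP => [->|i0].
    rewrite uniq_avoid andbT.
    by have := size_avoid K (map cv Ms ++ map (ce v) Rs); rewrite size_cat !size_map; lia.
  case: (leqP i (t + q)) => itq.
    cbv zeta; rewrite uniq_avoid andbT; set w := nth v s i.-1.
    have ws : w \in s by apply: mem_nth; rewrite ss; lia.
    have := size_avoid K (map (ce v) Rs ++ map (ce w) (Nb w)).
    rewrite size_cat !size_map sNb //.
    have [it|it] := leqP i t.
      have := bu i.-1; rewrite prednK; last by lia.
      have -> : nth v us i.-1 = w by rewrite /w nth_cat -/t ifT //; lia.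
      by move=> /(_ ltac:(lia)); lia.
    have ew : w = nth v xs (i.-1 - t) by rewrite /w nth_cat -/t ifF //; lia.
    have wx : w \in xs by rewrite ew mem_nth // -/q; lia.
    rewrite four //; have [] := bx (i.-1 - t) ltac:(lia).
    by rewrite (_ : (t + (i.-1 - t)).+1 = i); lia.
  cbv zeta; rewrite uniq_avoid andbT; set w := nth v xs _.
  have wx : w \in xs by apply: mem_nth; rewrite -/q; lia.
  have := size_avoid K (map cv (Nb w) ++ map (ce w) (Nb w)).
  rewrite size_cat !size_map sNb ?xs_s // four //.
  have [_] := bx (i - (t + q).+1) ltac:(lia).
  by rewrite (_ : (t + q + (i - (t + q).+1)).+1 = i); lia.
pose fe w := x (index w s).+1.
pose al w := x (t + q + index w xs).+1.
have is_ w : w \in s -> index w s < t + q by rewrite -index_mem ss.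
have ix w : w \in xs -> index w xs < q by rewrite -index_mem.
have uxs : uniq xs by move: us_; rewrite cat_uniq => /and3P[].
have fex w : w \in xs -> fe w = x (t + index w xs).+1.
  move=> wx; rewrite /fe index_cat ifF //; apply/negbTE/negP=> wu.
  by move: us_; rewrite cat_uniq => /and3P[_ /hasP[]]; exists w.
have sumx : \sum_(i < (t + q).+1) x i = x 0 + \sum_(w <- s) fe w.
  rewrite big_ord_recl; congr (_ + _); rewrite (big_nth v) ss big_mkord.
  by apply: eq_bigr => i _; rewrite /fe index_uniq ?ss.
apply: (@recolour_star _ g K gsym girr v us xs cv ce (x 0) fe al) => //.
- by rewrite /K; lia.
- by have := xA 0 isT; rewrite /A eqxx mem_avoid => /andP[].
- move=> w vw ws; have := xA 0 isT; rewrite /A eqxx mem_avoid mem_cat negb_or.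
  by case/and3P=> _ _; apply: contraNneq => <-; apply: map_f; rewrite mRs vw.
- move=> w vw dw wx; have wM : w \in Ms by rewrite mMs vw dw.
  split.
    have := xA 0 isT; rewrite /A eqxx mem_avoid mem_cat negb_or.
    by case/and3P=> _ + _; apply: contraNneq => ->; apply: map_f.
  have cin : (Posz (colour_sum h cv ce w) - Posz sgv)%R \in cS.
    by rewrite mem_cat; apply/orP; left; apply/mapP; exists w.
  have ne : x 0 + \sum_(w <- s) fe w + sgv != colour_sum h cv ce w.
    by have := xS _ cin; rewrite natz sumx; lia.
  exact: ne.
- move=> w ws; have wi := is_ w ws.
  have := xA (index w s).+1; rewrite /A /= wi nth_index // mem_avoid mem_cat negb_or.
  move=> /(_ ltac:(lia)) /and3P[w1 w2 w3]; split=> //.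
  + by apply: xinj => //; lia.
  + by move=> y vy ys; apply: contraNneq w2 => e; rewrite -/(fe w) e; apply: map_f; rewrite mRs vy.
  + by move=> y vy ys; apply: contraNneq w3 => e; rewrite -/(fe w) e; apply: map_f; rewrite mNb vy.
- move=> w y ws ys; apply: contra_eq => ne; apply: xinj; rewrite ?ltnS ?is_ // eqSS.
  by apply: contra_neq ne; exact: index_inj.
- move=> w wx; have wi := ix w wx.
  have [x1 x2 x3 x4] := xX _ wi; rewrite -fex // in x2 x3 x4.
  have hl : ((t + q + index w xs).+1 <= t + q) = false by lia.
  have := xA (t + q + index w xs).+1; rewrite /A [_ == 0]/= hl; cbv zeta.
  rewrite subSS addKn nth_index // mem_avoid mem_cat negb_or.
  move=> /(_ ltac:(lia)) /and3P[w1 w2 w3]; split=> //.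
  + have ne : al w + fe w + sgx w != x 0 + \sum_(w <- s) fe w + sgv.
      by move: x4; rewrite /dk nth_index // sumx !natz -/(al w); lia.
    exact: ne.
  + move=> y wy yv; have yN : y \in Nb w by rewrite mNb wy.
    split.
    * by apply: contraNneq w2 => e; rewrite -/(al w) e; apply: map_f.
    * by apply: contraNneq w3 => e; rewrite -/(al w) -e; apply: map_f.
    have cin : (Posz (colour_sum h cv ce y) - Posz (sgx w))%R \in cs (index w xs).
      by rewrite /cs nth_index //; apply/mapP; exists y.
    have ne : al w + fe w + sgx w != colour_sum h cv ce y.
      by have := x3 _ cin; rewrite natz -/(al w); lia.
    exact: ne.
Qed.

(** * Reducible configurations and discharging *)

Section Reducible.
Variables (T : finType) (g : rel T) (D : nat).
Hypotheses (gsym : symmetric g) (girr : irreflexive g) (D8 : 8 <= D).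
Hypothesis degD : forall v, deg g v <= D.
Hypothesis IH : forall h : rel T, simple_graph h -> (forall x y, h x y -> g x y) ->
  #|[set p : T * T | h p.1 p.2]| < #|[set p : T * T | g p.1 p.2]| ->
  tnsd_index_le h (D + 3).

Definition nbrs2 v := [set u | g v u & deg g u <= 2].
Definition nbrs_eq k v := [set u | g v u & deg g u == k].
Definition nbrs_big v := [set u | g v u & 3 < deg g u].

Lemma deg_split v : deg g v = #|nbrs2 v| + #|nbrs_eq 3 v| + #|nbrs_big v|.
Proof.
rewrite /deg -(cardsID (nbrs2 v)) -addnA; congr (_ + _).
  by apply: eq_card => u; rewrite !inE; case: (g v u).
rewrite -(cardsID (nbrs_eq 3 v)); congr (_ + _); apply: eq_card => u; rewrite !inE.
  by case: (g v u) => //=; lia.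
by case: (g v u); rewrite ?andbF //=; lia.
Qed.

Lemma nbrs4_big v : nbrs_eq 4 v \subset nbrs_big v.
Proof. by apply/subsetP=> u; rewrite !inE => /andP[-> /eqP ->]. Qed.

(** The star consists of [t] small neighbours and [q] 4-neighbours, all other edges at [v] being
    kept. An edge to a neighbour of degree at most 2 meets at most one further edge at its far end,
    against two for a 3-neighbour; this is the final summand 1 or 2. *)
Lemma star_config v t q M b :
    let s2 := #|nbrs2 v| in let s3 := #|nbrs_eq 3 v| in
    t <= s2 + s3 -> q <= #|nbrs_eq 4 v| ->
    (q <= 1 \/ {in nbrs_eq 4 v &, forall x y, ~~ g x y}) -> 0 < t + q ->
    deg g v <= s2 + s3 + q + M -> star_ok t q M b ->
    nth 0 b 0 + (deg g v - (t + q)) + M < D + 3 ->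
    (forall i, i < t -> nth 0 b i.+1 + (deg g v - (t + q)) + (if i < s2 then 1 else 2) < D + 3) ->
    (forall k, k < q -> nth 0 b (t + k).+1 + (deg g v - (t + q)) < D
                        /\ nth 0 b (t + q + k).+1 + 3 < D) ->
  tnsd_index_le g (D + 3).
Proof.
move=> s2 s3 ts qs indep tq dM ok b0 bu bx.
(* Neighbours of degree at most 2 come first, so that they take the first exponents. *)
pose sm := enum (nbrs2 v) ++ enum (nbrs_eq 3 v).
pose us := take t sm; pose xs := take q (enum (nbrs_eq 4 v)).
have ssm : size sm = s2 + s3 by rewrite size_cat -!cardE.
have sus : size us = t by rewrite size_takel // ssm.
have sxs : size xs = q by rewrite size_takel // -cardE.
have usm u : u \in us -> g v u && (deg g u <= 3).
  move/mem_take; rewrite mem_cat !mem_enum !inE => /orP[] /andP[-> du] /=; last by rewrite (eqP du).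
  by rewrite (leq_trans du).
have xsm x : x \in xs -> x \in nbrs_eq 4 v by move/mem_take; rewrite mem_enum.
have xs4 x : x \in xs -> g v x /\ deg g x = 4 by move/xsm; rewrite inE => /andP[-> /eqP].
have uxs : uniq xs by rewrite take_uniq ?enum_uniq.
apply: (@star_reducible _ g D v us xs M (deg g v - (t + q)) b) => //; rewrite ?sus ?sxs //.
- by rewrite size_cat sus sxs.
- rewrite cat_uniq uxs andbT take_uniq /=; last first.
    rewrite cat_uniq !enum_uniq andbT /=; apply/hasPn=> u; rewrite !mem_enum !inE.
    by case/andP=> _ /eqP ->; rewrite andbF.
  by apply/hasPn=> x /xs4[_ dx]; apply/negP=> /usm; rewrite dx andbF.
- by move=> w; rewrite mem_cat => /orP[/usm/andP[] // | /xs4[]].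
- by move=> u /usm /andP[].
- by move=> x /xs4[].
- case: indep => [q1|indep]; last by move=> x y /xsm xx /xsm yy; apply: indep.
  move=> x y; case: (xs) sxs => [|z [|z' zs]] //=; last by lia.
  by move=> _; rewrite !inE => /eqP -> /eqP ->; rewrite girr.
- by rewrite -leq_subLR leqnn.
- rewrite -(leq_add2r q).
  have -> : #|[set w | [&& g v w, 3 < deg g w & w \notin xs]]| + q = #|nbrs_big v|.
    rewrite -(cardsID [set x in xs] (nbrs_big v)) addnC; congr (_ + _).
      rewrite -sxs -(card_uniqP uxs); apply: eq_card => x; rewrite !inE.
      by rewrite andb_idl // => /xs4[-> ->].
    by apply: eq_card => x; rewrite !inE; case: (x \in xs); rewrite ?andbF ?andbT //=; case: (g v x).
  by have := deg_split v; rewrite -/s2 -/s3; lia.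
- move=> i it; have := bu i it.
  suff : (deg g (nth v us i)).-1 <= (if i < s2 then 1 else 2) by lia.
  case: ifP => i2.
    rewrite nth_take // nth_cat -cardE -/s2 i2.
    have : nth v (enum (nbrs2 v)) i \in nbrs2 v by rewrite -mem_enum mem_nth // -cardE.
    by rewrite inE => /andP[_]; lia.
  have /usm/andP[_] : nth v us i \in us by rewrite mem_nth // sus.
  by lia.
Qed.

Ltac star_side := rewrite /=;
  try (move=> [|[|[|[|?]]]] //= _; repeat case: ifP => ?); lia.

Lemma small_nbr v u : g v u -> deg g u <= 3 -> 0 < #|nbrs2 v| + #|nbrs_eq 3 v|.
Proof.
move=> vu du; rewrite -cardsUI; apply: leq_trans (leq_addr _ _).
by apply/card_gt0P; exists u; rewrite !inE vu; lia.
Qed.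

Lemma small_adj_le5 v :
  0 < #|nbrs2 v| + #|nbrs_eq 3 v| -> deg g v <= 5 -> tnsd_index_le g (D + 3).
Proof.
move=> t1 dv.
apply: (star_config (v := v) _ _ _ _ _ star_ok_1_0_4); star_side.
Qed.

Lemma four_adj_four v :
  0 < #|nbrs_eq 4 v| -> deg g v = 4 -> tnsd_index_le g (D + 3).
Proof.
move=> q1 dv; apply: (star_config (v := v) _ _ _ _ _ star_ok_0_1_3); star_side.
Qed.

(** If two 4-neighbours of [v] are adjacent, [four_adj_four] applies to one of them; otherwise two
    of them can be recoloured independently. *)
Lemma five_adj_fours v :
  1 < #|nbrs_eq 4 v| -> deg g v = 5 -> tnsd_index_le g (D + 3).
Proof.
move=> q2 dv.
have [/'exists_existsP[x [y /and3P[xv yv xy]]]|] :=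
  boolP [exists x, exists y, [&& x \in nbrs_eq 4 v, y \in nbrs_eq 4 v & g x y]].
  rewrite !inE in xv yv; apply: (@four_adj_four x); last by apply/eqP; case/andP: xv.
  by apply/card_gt0P; exists y; rewrite inE xy; case/andP: yv.
rewrite negb_exists => /forallP ind.
apply: (star_config (v := v) _ _ _ _ _ star_ok_0_2_3); try star_side.
right=> x y xv yv; apply/negP=> xy; have := ind x; rewrite negb_exists => /forallP /(_ y).
by rewrite xv yv xy.
Qed.

(** A vertex that cannot pay its gifts is reducible. With [m] neighbours of degree at least 4, the
    inequality reads [8 * s3 + 18 * m < 84 + 3 * s4]; as [s4 <= m], this forces [m <= 5], and each
    remaining case has a certificate. *)
Lemma rich_vertex v : 5 <= deg g v ->
  18 * (deg g v - #|nbrs2 v|) < 84 + 10 * #|nbrs_eq 3 v| + 3 * #|nbrs_eq 4 v| ->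
  tnsd_index_le g (D + 3).
Proof.
move=> d5; have := subset_leq_card (nbrs4_big v); have := deg_split v.
set d := deg g v; set s := #|nbrs2 v|; set s3 := #|nbrs_eq 3 v|; set s4 := #|nbrs_eq 4 v|.
set m := #|nbrs_big v| => dE s4m lt.
have dD : d <= D by apply: degD.
have star t q M b := @star_config v t q M b.
rewrite -/d -/s -/s3 -/s4 /= in star.
have [m1|m2] := leqP m 1.
  by apply: (star _ _ _ _ _ _ _ _ _ star_ok_1_0_1); star_side.
have [d5'|d6] := leqP d 5.
  have [s0|s0] := posnP (s + s3); last exact: small_adj_le5 s0 d5'.
  have [s42|s41] := leqP 2 s4; last by lia.
  by apply: five_adj_fours s42 _; lia.
have [d6'|d7] := leqP d 6.
  have [t2|t1] := leqP 2 (s + s3).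
    by apply: (star _ _ _ _ _ _ _ _ _ star_ok_2_0_4); star_side.
  have [t0|t0] := posnP (s + s3); first by lia.
  have [s40|s40] := posnP s4; first by lia.
  by apply: (star _ _ _ _ _ _ _ _ _ star_ok_1_1_4); star_side.
have [d7'|d8] := leqP d 7.
  have [t3|t2] := leqP 3 (s + s3).
    by apply: (star _ _ _ _ _ _ _ _ _ star_ok_3_0_4); star_side.
  (* A neighbour of degree at most 2 must exist; its edge has room for the exponent 5 in
     [star_ok_2_1_4]. *)
  have [s0|s0] := posnP s; first by lia.
  have [t2'|t1] := leqP 2 (s + s3); last by lia.
  have [s40|s40] := posnP s4; first by lia.
  by apply: (star _ _ _ _ _ _ _ _ _ star_ok_2_1_4); star_side.
(* Without neighbours of degree at most 2, the inequality leaves only [m = 2] with a 4-neighbour.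
   Otherwise such a neighbour takes the exponent 5 of the later certificates. *)
have [s0|s0] := posnP s.
  have [s40|s40] := posnP s4; first by lia.
  have [m2'|m3] := leqP m 2; last by lia.
  by apply: (star _ _ _ _ _ _ _ _ _ star_ok_1_1_1); star_side.
have [t4|t3] := leqP 4 (s + s3).
  have [m5|m6] := leqP m 5; last by lia.
  by apply: (star _ _ _ _ _ _ _ _ _ star_ok_4_0_5); star_side.
have [d8'|d9] := leqP d 8; last by lia.
have [t3'|t2] := leqP 3 (s + s3); last by lia.
have [s40|s40] := posnP s4; first by lia.
by apply: (star _ _ _ _ _ _ _ _ _ star_ok_3_1_4); star_side.
Qed.

(* Discharging weights: a vertex [v] of the subgraph induced by the vertices of degree at
   least 3 starts with [18] times its degree there minus [84]; a [k]-vertex receives [gift k]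
   from each of its neighbours. *)
Definition gift (k : nat) : nat := if k == 3 then 10 else if k == 4 then 3 else 0.

Definition core_adj : rel T := fun u v => [&& g u v, 3 <= deg g u & 3 <= deg g v].

Lemma core_deg v : 3 <= deg g v -> #|[set u | core_adj v u]| = deg g v - #|nbrs2 v|.
Proof.
move=> d3; rewrite /deg -(cardsID (nbrs2 v) [set u | g v u]).
have -> : [set u | g v u] :&: nbrs2 v = nbrs2 v.
  by apply/setP=> u; rewrite !inE andbA andbb.
rewrite addKn; apply: eq_card => u; rewrite !inE /core_adj d3 /= ltnNge.
by case: (g v u); rewrite ?andbF ?andbT.
Qed.

Lemma sum_gift v : 3 <= deg g v ->
  \sum_(u | core_adj v u) gift (deg g u) = 10 * #|nbrs_eq 3 v| + 3 * #|nbrs_eq 4 v|.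
Proof.
move=> d3; rewrite !(mulnC _ #|_|) -!sum_nat_const.
rewrite (big_mkcond (core_adj v)) (big_mkcond (mem (nbrs_eq 3 v))) /=.
rewrite (big_mkcond (mem (nbrs_eq 4 v))) /= -big_split /=.
apply: eq_bigr => u _; rewrite !inE /core_adj d3 /gift; case: (g v u) => //=.
by do !case: ifP => //; lia.
Qed.

(** Since [28 * 3 = 21 * 4 = 84], a vertex of degree 3 or 4 whose neighbours all have degree at
    least 5 breaks even; any other neighbour makes the graph reducible. *)
Lemma poor_vertex v : 3 <= deg g v ->
    (18 + gift (deg g v)) * #|[set u | core_adj v u]|
      < 84 + \sum_(u | core_adj v u) gift (deg g u) ->
  tnsd_index_le g (D + 3).
Proof.
move=> d3; rewrite core_deg // sum_gift // => lt.
have [d5|d4] := leqP 5 (deg g v).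
  by apply: (rich_vertex d5); move: lt; rewrite /gift !ifF; lia.
have [s0|s0] := posnP (#|nbrs2 v| + #|nbrs_eq 3 v|); last first.
  by apply: small_adj_le5 s0 _; lia.
have [s4|s4] := posnP #|nbrs_eq 4 v|.
  by move: lt; rewrite /gift; do !case: ifP => //; lia.
have [d4'|d4'] := eqVneq (deg g v) 4; first exact: four_adj_four s4 d4'.
(* A 3-vertex with a 4-neighbour [u]: seen from [u], it is a small neighbour. *)
case/card_gt0P: s4 => u; rewrite inE => /andP[vu /eqP du].
apply: (@small_adj_le5 u); last by rewrite du.
by apply: (@small_nbr u v); [rewrite gsym | lia].
Qed.

Lemma discharge : mad_lt g 14 3 -> tnsd_index_le g (D + 3).
Proof.
move=> mad; pose W := [set v | 3 <= deg g v].
(* An empty core gives no density bound. All degrees are then at most 3: an edge is reducible, and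
   an edgeless graph is coloured vertex by vertex. *)
have [W0|W0] := posnP #|W|.
  have small v : deg g v <= 3.
    apply: contraT; rewrite -ltnNge => dv.
    have : v \in W by rewrite inE ltnW.
    by rewrite (cards0_eq W0) inE.
  have [/existsP[v dv]|] := boolP [exists v, 0 < deg g v].
    case/card_gt0P: dv => u; rewrite inE => vu.
    apply: (@small_adj_le5 v); first exact: small_nbr vu _.
    by rewrite (leq_trans (small v)).
  rewrite negb_exists => /forallP nodeg.
  have ng u v : g u v = false.
    apply: negbTE; apply: contra (nodeg u) => uv.
    by apply/card_gt0P; exists v; rewrite inE.
  apply: (@colour_small_vertices _ g _ gsym girr (fun=> 0) (fun _ _ => 0) set0) => //.
  - by lia.
  - by split=> [u v|u v|u v w]; rewrite ng.
  - by move=> u; rewrite inE.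
have [/existsP[v /andP[d3 lt]]|] := boolP [exists v, (3 <= deg g v) &&
    ((18 + gift (deg g v)) * #|[set u | core_adj v u]|
      < 84 + \sum_(u | core_adj v u) gift (deg g u))].
  exact: poor_vertex d3 lt.
rewrite negb_exists => /forallP rich.
have csym : symmetric core_adj by move=> u v; rewrite /core_adj gsym; congr (_ && _); rewrite andbC.
have mad' := mad W core_adj csym _ _ W0.
have {mad'} ltE : 3 * (\sum_v #|[set u | core_adj v u]|) < 14 * #|W|.
  have -> : \sum_v #|[set u | core_adj v u]| = #|[set p : T * T | core_adj p.1 p.2]|.
    rewrite -sum1dep_card -(pair_big_dep predT core_adj (fun _ _ => 1)) /=.
    by apply: eq_bigr => v _; rewrite sum1dep_card.
  by apply: mad' => u v; rewrite ?inE => /and3P[] // _ -> ->.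
(* Gifts paid and gifts received have the same total. *)
have gifts : \sum_v \sum_(u | core_adj v u) gift (deg g u)
    = \sum_v gift (deg g v) * #|[set u | core_adj v u]|.
  rewrite (exchange_big_dep predT) //=; apply: eq_bigr => v _.
  by rewrite sum_nat_const mulnC; congr (_ * _); apply: eq_card => u; rewrite inE csym.
(* After cancelling the gifts, this says that 18 times the sum of the core degrees is at least
   [84 * #|W|], contradicting six times [ltE]. *)
have : \sum_v ((if v \in W then 84 else 0) + \sum_(u | core_adj v u) gift (deg g u))
    <= \sum_v (18 + gift (deg g v)) * #|[set u | core_adj v u]|.
  apply: leq_sum => v _; rewrite inE; case: ifP => d3.
    by have := rich v; rewrite d3 /= -leqNgt.
  by rewrite big_pred0 // => u; rewrite /core_adj d3 andbF.
rewrite big_split /= gifts -big_mkcond /= sum_nat_const.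
have -> : \sum_v (18 + gift (deg g v)) * #|[set u | core_adj v u]|
    = 18 * \sum_v #|[set u | core_adj v u]| + \sum_v gift (deg g v) * #|[set u | core_adj v u]|.
  by rewrite big_distrr -big_split /=; apply: eq_bigr => v _; rewrite mulnDl.
by move=> leE; exfalso; lia.
Qed.

End Reducible.

(** [D] is only an upper bound on the degrees: deleting edges may lower the maximum degree, while
    the number of colours must stay fixed in the induction. *)
Lemma tnsd_of_mad (T : finType) (D : nat) (g : rel T) : 8 <= D ->
  simple_graph g -> (forall v, deg g v <= D) -> mad_lt g 14 3 -> tnsd_index_le g (D + 3).
Proof.
move=> D8; have [n] := ubnP #|[set p : T * T | g p.1 p.2]|.
elim: n g => // n IHn g le [gsym girr] degD mad.
apply: discharge => // h hs hg lt; apply: IHn => //.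
- by rewrite (leq_trans lt).
- move=> v; apply: leq_trans (degD v); apply: subset_leq_card.
  by apply/subsetP=> u; rewrite !inE; apply: hg.
- by move=> S k ks kh; apply: mad => // u v /kh /hg.
Qed.

Theorem theorem5 (T : finType) (g : rel T) :
  simple_graph g ->
  8 <= maxdeg g ->
  mad_lt g 14 3 ->
  tnsd_index_le g (maxdeg g + 3).
Proof.
move=> gs D8; apply: tnsd_of_mad => // v.
exact: (@leq_bigmax _ (deg g)).
Qed.
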